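(* Let $(\mathfrak{g},\pi_1,\pi_2)$ be a compatible $3$-Lie algebra. For $n\ge1$ let $\mathfrak{C}^n_{\mathrm{3Lie}}(\mathfrak{g},\mathfrak{g})=C^{n-1}(\mathfrak{g},\mathfrak{g})$ and let $\mathfrak{C}^n_{\mathrm{c3Lie}}(\mathfrak{g},\mathfrak{g})$ be the direct sum of $n$ copies of $\mathfrak{C}^n_{\mathrm{3Lie}}(\mathfrak{g},\mathfrak{g})$. Define $\mathbb{d}^1 f=([\pi_1,f]_{\mathrm{3Lie}},[\pi_2,f]_{\mathrm{3Lie}})$ for $f\in\mathrm{Hom}(\mathfrak{g},\mathfrak{g})$, and for $n>1$ define $\mathbb{d}^n:\mathfrak{C}^n_{\mathrm{c3Lie}}(\mathfrak{g},\mathfrak{g})\to\mathfrak{C}^{n+1}_{\mathrm{c3Lie}}(\mathfrak{g},\mathfrak{g})$ by $$\mathbb{d}^n(\omega_1,\dots,\omega_n)=(-1)^{n-1}\big([\pi_1,\omega_1]_{\mathrm{3Lie}},\dots,\underbrace{[\pi_2,\omega_{i-1}]_{\mathrm{3Lie}}+[\pi_1,\omega_i]_{\mathrm{3Lie}}}_{i\text{-th component},\ 2\le i\le n},\dots,[\pi_2,\omega_n]_{\mathrm{3Lie}}\big).$$ Then $\mathbb{d}^{n+1}\circ\mathbb{d}^n=0$ for all $n\ge1$, i.e. $(\mathfrak{C}^*_{\mathrm{c3Lie}}(\mathfrak{g},\mathfrak{g})=\oplus_{n=1}^\infty\mathfrak{C}^n_{\mathrm{c3Lie}}(\mathfrak{g},\mathfrak{g}),\mathbb{d}^*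 )$ is a cochain complex.
   Context: All vector spaces are finite-dimensional over an algebraically closed field $\mathbb{K}$ of characteristic $0$. A 3-Lie algebra is a vector space $\mathfrak{g}$ with a skew-symmetric trilinear map $[\cdot,\cdot,\cdot]:\wedge^3\mathfrak{g}\to\mathfrak{g}$ such that $[x_1,x_2,[x_3,x_4,x_5]]=[[x_1,x_2,x_3],x_4,x_5]+[x_3,[x_1,x_2,x_4],x_5]+[x_3,x_4,[x_1,x_2,x_5]]$ for all $x_i\in\mathfrak{g}$. A compatible 3-Lie algebra is a triple $(\mathfrak{g},[\cdot,\cdot,\cdot],\{\cdot,\cdot,\cdot\})$ where $[\cdot,\cdot,\cdot]$ and $\{\cdot,\cdot,\cdot\}$ are 3-Lie algebra structures on $\mathfrak{g}$ such that for all $x_1,\dots,x_5\in\mathfrak{g}$: $[x_1,x_2,\{x_3,x_4,x_5\}]+\{x_1,x_2,[x_3,x_4,x_5]\}=[\{x_1,x_2,x_3\},x_4,x_5]+\{[x_1,x_2,x_3],x_4,x_5\}+[x_3,\{x_1,x_2,x_4\},x_5]+\{x_3,[x_1,x_2,x_4],x_5\}+[x_3,x_4,\{x_1,x_2,x_5\}]+\{x_3,x_4,[x_1,x_2,x_5]\}$. Here $\pi_1(x,y,z)=[x,y,z]$ and $\pi_2(x,y,z)=\{x,y,z\}$. The graded Lie algebra $(C^*(\mathfrak{g},\mathfrak{g}),[\cdot,\cdot]_{\mathrm{3Lie}})$: $C^*(\mathfrak{g},\mathfrak{g})=\oplus_{n\ge0}C^n(\mathfrak{g},\mathfrak{g})$,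 where $C^n(\mathfrak{g},\mathfrak{g})=\mathrm{Hom}(\underbrace{\wedge^2\mathfrak{g}\otimes\cdots\otimes\wedge^2\mathfrak{g}}_{n}\wedge\mathfrak{g},\mathfrak{g})$ has degree $n$; here for $n\ge1$ the domain means $(\wedge^2\mathfrak{g})^{\otimes(n-1)}\otimes\wedge^3\mathfrak{g}$ (the last $\wedge^2\mathfrak{g}$ is wedged with $\mathfrak{g}$), and for $n=0$ it is $\mathfrak{g}$; so $C^0=\mathrm{Hom}(\mathfrak{g},\mathfrak{g})$, $C^1=\mathrm{Hom}(\wedge^3\mathfrak{g},\mathfrak{g})$. For $P\in C^p$, $Q\in C^q$, $[P,Q]_{\mathrm{3Lie}}=P\circ Q-(-1)^{pq}Q\circ P$, where, with $\mathfrak{X}_i=x_i\wedge y_i\in\wedge^2\mathfrak{g}$, $x\in\mathfrak{g}$, $$\begin{aligned}&(P\circ Q)(\mathfrak{X}_1,\dots,\mathfrak{X}_{p+q},x)\\=&\sum_{k=1}^p(-1)^{(k-1)q}\sum_{\sigma\in S(k-1,q)}(-1)^\sigma P\big(\mathfrak{X}_{\sigma(1)},\dots,\mathfrak{X}_{\sigma(k-1)},Q(\mathfrak{X}_{\sigma(k)},\dots,\mathfrak{X}_{\sigma(k+q-1)},x_{k+q})\wedge y_{k+q},\mathfrak{X}_{k+q+1},\dots,\mathfrak{X}_{p+q},x\big)\\&+\sum_{k=1}^p(-1)^{(k-1)q}\sum_{\sigma\in S(k-1,q)}(-1)^\sigma P\big(\mathfrak{X}_{\sigma(1)},\dots,\mathfrak{X}_{\sigma(k-1)},x_{k+q}\wedge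 Q(\mathfrak{X}_{\sigma(k)},\dots,\mathfrak{X}_{\sigma(k+q-1)},y_{k+q}),\mathfrak{X}_{k+q+1},\dots,\mathfrak{X}_{p+q},x\big)\\&+\sum_{\sigma\in S(p,q)}(-1)^{pq}(-1)^\sigma P\big(\mathfrak{X}_{\sigma(1)},\dots,\mathfrak{X}_{\sigma(p)},Q(\mathfrak{X}_{\sigma(p+1)},\dots,\mathfrak{X}_{\sigma(p+q)},x)\big),\end{aligned}$$ where $S(a,b)$ is the set of $(a,b)$-shuffles, i.e. permutations $\sigma$ of $\{1,\dots,a+b\}$ with $\sigma(1)<\dots<\sigma(a)$ and $\sigma(a+1)<\dots<\sigma(a+b)$. It is known that this is a graded Lie algebra. *)

(* Defs.v *)
From HB Require Import structures.
From mathcomp Require Import all_boot all_order all_fingroup all_algebra.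
From mathcomp Require Import boolp functions.

Set Implicit Arguments.
Unset Strict Implicit.
Unset Printing Implicit Defensive.

Import GRing.Theory.
Local Open Scope ring_scope.

Definition trilinear (K : fieldType) (g : vectType K) (br : g -> g -> g -> g) :=
  [/\ forall y z, linear (fun x => br x y z),
      forall x z, linear (fun y => br x y z)
    & forall x y, linear (fun z => br x y z)].

(* The two transpositions generate the symmetric group on three letters. *)
Definition skew3 (K : fieldType) (g : vectType K) (br : g -> g -> g -> g) :=
  (forall x y z, br y x z = - br x y z) /\
  (forall x y z, br x z y = - br x y z).

Definition three_Lie (K : fieldType) (g : vectType K) (br : g -> g -> g -> g) :=
  [/\ trilinear br, skew3 br
    & forall x1 x2 x3 x4 x5,
        br x1 x2 (br x3 x4 x5) =
          br (br x1 x2 x3) x4 x5 + br x3 (br x1 x2 x4) x5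
          + br x3 x4 (br x1 x2 x5)].

Definition compatible_three_Lie (K : fieldType) (g : vectType K)
    (br1 br2 : g -> g -> g -> g) :=
  [/\ three_Lie br1, three_Lie br2
    & forall x1 x2 x3 x4 x5,
        br1 x1 x2 (br2 x3 x4 x5) + br2 x1 x2 (br1 x3 x4 x5) =
          br1 (br2 x1 x2 x3) x4 x5 + br2 (br1 x1 x2 x3) x4 x5
          + br1 x3 (br2 x1 x2 x4) x5 + br2 x3 (br1 x1 x2 x4) x5
          + br1 x3 x4 (br2 x1 x2 x5) + br2 x3 x4 (br1 x1 x2 x5)].

(* A map on tensor and exterior powers is encoded by the multilinear map, with
   the corresponding skew-symmetries, that it induces on vectors: an entry
   (x, y) of the tuple stands for the bivector x /\ y.  [multimap g n] is the
   ambient space of all functions (with the pointwise vector space structure);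
   the space C^n(g, g) is cut out of it by [is_cochain]. *)
Notation multimap g n := (n.-tuple (g * g)%type -> g -> g).

Definition subst_at (T : Type) (n : nat) (X : n.-tuple T) (i : 'I_n) (v : T) :
    n.-tuple T :=
  [tuple if j == i then v else tnth X j | j < n].

(* For n > 0, the last clause together with skew-symmetry inside the last pair
   says that f is skew-symmetric in its last three vector arguments, i.e. that
   f is defined on (/\^2 g)^(n-1) (x) /\^3 g; for n = 0 only linearity is left. *)
Definition is_cochain (K : fieldType) (g : vectType K) (n : nat)
    (f : multimap g n) : Prop :=
  [/\ forall X, linear (f X),
      forall X i y z, linear (fun x => f (subst_at X i (x, y)) z),
      forall X i x z, linear (fun y => f (subst_at X i (x, y)) z),
      forall X i x y z,
        f (subst_at X i (y, x)) z = - f (subst_at X i (x, y)) z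
    & forall X (i : 'I_n) x y z, i.+1 = n ->
        f (subst_at X i (x, z)) y = - f (subst_at X i (x, y)) z].

Definition shuffles (a b : nat) : {set 'S_(a + b)} :=
  [set s : 'S_(a + b) |
    [forall i : 'I_(a + b), forall j : 'I_(a + b),
      (i < j)%N && ((j < a) || (a <= i))%N ==> (s i < s j)%N]].

(* The sequence s read as a p-tuple; only used when size s = p. *)
Definition astuple (V : nmodType) (p : nat) (s : seq V) : p.-tuple V :=
  [tuple s`_j | j < p].

(* Positions are counted from 0, so the index k below is k - 1 for the usual
   k = 1, ..., p; the default value of the subscripts is never reached. *)
Definition circ (K : fieldType) (g : vectType K) (p q : nat)
    (P : multimap g p) (Q : multimap g q) : multimap g (p + q) :=
  fun X x =>
    \sum_(k < p) (-1 : K) ^+ (k * q) *: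
      \sum_(s in shuffles k q) (-1 : K) ^+ s *:
        P (astuple p
             ([tuple X`_(s (lshift q i)) | i < k] ++
              (Q [tuple X`_(s (rshift k i)) | i < q] (X`_(k + q)).1,
               (X`_(k + q)).2) ::
              drop (k + q).+1 X)) x
  + \sum_(k < p) (-1 : K) ^+ (k * q) *:
      \sum_(s in shuffles k q) (-1 : K) ^+ s *:
        P (astuple p
             ([tuple X`_(s (lshift q i)) | i < k] ++
              ((X`_(k + q)).1,
               Q [tuple X`_(s (rshift k i)) | i < q] (X`_(k + q)).2) ::
              drop (k + q).+1 X)) x
  + \sum_(s in shuffles p q) (-1 : K) ^+ (p * q) *: ((-1 : K) ^+ s *:
      P [tuple X`_(s (lshift q i)) | i < p]
        (Q [tuple X`_(s (rshift p i)) | i < q] x)).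

Definition bracket3Lie (K : fieldType) (g : vectType K) (p q : nat)
    (P : multimap g p) (Q : multimap g q) : multimap g (p + q) :=
  fun X x =>
    circ P Q X x - (-1 : K) ^+ (p * q) *: circ Q P (tcast (addnC p q) X) x.

Definition pi_cochain (K : fieldType) (g : vectType K) (br : g -> g -> g -> g) :
    multimap g 1 :=
  fun X z => br (thead X).1 (thead X).2 z.

(* The degree is shifted to make n >= 1 structural: families indexed by 'I_n.+1
   with entries in C^n(g, g) are the elements of degree n.+1 of the complex of
   the compatible 3-Lie algebra. *)
Notation multimaps g n := ('I_n.+1 -> multimap g n).

Definition is_c3cochain (K : fieldType) (g : vectType K) (n : nat)
    (w : multimaps g n) : Prop :=
  forall i, is_cochain (w i).

(* The differential out of degree n.+1.  With i counted from 0 the i-th component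
   is the sum of [pi_2, w (i - 1)], present unless i = 0, and [pi_1, w i], present
   unless i = n.+1 is the last index.  For n = 0 this is ([pi_1, f], [pi_2, f]). *)
Definition c3d (K : fieldType) (g : vectType K) (br1 br2 : g -> g -> g -> g)
    (n : nat) (w : multimaps g n) : multimaps g n.+1 :=
  fun i => (-1 : K) ^+ n *:
    ((if unlift ord0 i is Some j
      then bracket3Lie (pi_cochain br2) (w j) else 0)
     + (if unlift ord_max i is Some j
        then bracket3Lie (pi_cochain br1) (w j) else 0)
     : multimap g n.+1).

(* Main.v *)
From HB Require Import structures.
Require Import Defs.
From mathcomp Require Import all_boot all_order all_fingroup all_algebra.
From mathcomp Require Import boolp functions ring zify.

Set Implicit Arguments.
Unset Strict Implicit.
Unset Printing Implicit Defensive.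

Import GRing.Theory.
Local Open Scope ring_scope.

(** The bracket with pi is, up to sign, a Chevalley-Eilenberg differential, and
    its square is computed here by a Cartan calculus instead of by cancelling
    terms in the sum over shuffles.

    Fixing the first bivector Z of a cochain f gives a cochain [contract Z f] of
    one degree less, and f is determined by its contractions.  An endomorphism A
    of g acts on cochains by the usual derivation [lieD A].  Write ad_Z for
    br z1 z2.  The operator [cobd br] is defined by recursion on the degree so
    that Cartan's formula
      contract Z (cobd br f) = lieD ad_Z f - cobd br (contract Z f)
    holds by construction in positive degree, starting in degree 0 from cobd br f = - lieD f pi.
    Then:
    - [lieD] is an action of the Lie algebra gl(g) ([lieD_commutator]);
    - if A is a derivation of br, that is lieD A pi = 0, then [lieD A] commutes
      with [cobd br] ([lieD_cobd]);
    - the fundamental identity says precisely that every ad_Z is a derivation,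
      and Cartan's formula then gives by induction
        contract Z (cobd br (cobd br f))
          = lieD ad_Z (cobd br f) - cobd br (lieD ad_Z f)
            + cobd br (cobd br (contract Z f)) = 0     ([cobd_cobd]).

    Compatibility of br1 and br2 means that br1 + br2 is again a 3-Lie bracket,
    and [cobd] is additive in the bracket on cochains, so expanding the square of
    the differential of br1 + br2 leaves the anticommutation of the two
    differentials ([cobd_anticomm]).

    The link with the shuffle formula is [bracket3Lie_pi]: the bracket of pi and
    f is (-1)^n cobd br f.  A shuffle of type (1, q) or (k, 1) is determined by
    the value it takes at the isolated position, so the sums over shuffles become
    sums over one index ([sum_shuffles_1l], [sum_shuffles_1r]), which are matched
    with the recursion of [cobd] unrolled once and for all in [cobdE].

    The signs (-1)^n then cancel in [c3d], and a component of its square is a sum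
    of the squares of the two differentials and of their anticommutator. *)

(** * Vector identities *)

(** Linear forms separate vectors; this turns identities between vectors into
    identities between scalars, where [ring] applies.  The form is a bare
    function with its linearity laws, which then serve as rewriting rules that
    act on this form and on no other linear map. *)
Lemma scalar_sep (K : fieldType) (g : vectType K) (u v : g) :
  (forall phi : g -> K,
      [/\ forall x y, phi (x + y) = phi x + phi y,
          forall x, phi (- x) = - phi x,
          forall a x, phi (a *: x) = a * phi x
        & phi 0 = 0] ->
    phi u = phi v) -> u = v.
Proof.
move=> uv; rewrite (coord_vbasis (memvf u)) (coord_vbasis (memvf v)).
apply: eq_bigr => i _; congr (_ *: _); apply: (uv (coord _ i)).
by split=> *; rewrite (linearD, linearN, linearZ, linear0).
Qed.

Ltac vec_ring :=
  let phi := fresh "phi" in let phiD := fresh "phiD" in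
  let phiN := fresh "phiN" in let phiZ := fresh "phiZ" in
  let phi0 := fresh "phi0" in
  apply: scalar_sep => phi [phiD phiN phiZ phi0];
  rewrite ?(phiD, phiN, phiZ, phi0);
  ring.

Ltac mm_ring := apply/funext => ?; apply/funext => ?; rewrite ?fctE; vec_ring.

(** * Contractions, the action of endomorphisms, the differential *)

Section Cartan.
Variables (K : fieldType) (g : vectType K).

Definition contract n (Z : g * g) (f : multimap g n.+1) : multimap g n :=
  fun X => f (cons_tuple Z X).

Definition contract_act n (A : g -> g) (W : g * g) (f : multimap g n.+1) :
    multimap g n :=
  contract (A W.1, W.2) f + contract (W.1, A W.2) f.

(** The induction step of most proofs below: an identity in degree n.+1 is
    checked after contraction with an arbitrary bivector. *)
Lemma multimap_eq n (f h : multimap g n.+1) :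
  (forall Z, contract Z f = contract Z h) -> f = h.
Proof.
by move=> fh; apply/funext => X; case/tupleP: X => Z X; exact: (congr1 (@^~ X) (fh Z)).
Qed.

(** The derivation action of an endomorphism A of g on multilinear maps: A acts
    on the value and, with a minus sign, on each vector argument.  The recursion
    treats the first bivector apart; [lieDE] gives the closed form. *)
Fixpoint lieD n (A : g -> g) : multimap g n -> multimap g n :=
  match n with
  | 0 => fun f X x => A (f X x) - f X (A x)
  | n'.+1 => fun f X =>
      (lieD A (contract (thead X) f) - contract_act A (thead X) f)
        (behead_tuple X)
  end.

(** In positive degree this is Cartan's formula taken as a definition.  In
    degree 0 the cochain is an endomorphism f and the value is minus its action
    on the bracket, which measures the failure of f to be a derivation. *)
Fixpoint cobd br n : multimap g n -> multimap g n.+1 :=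
  match n with
  | 0 => fun f => - lieD (f [tuple]) (pi_cochain br)
  | n'.+1 => fun f X =>
      (lieD (br (thead X).1 (thead X).2) f - cobd br (contract (thead X) f))
        (behead_tuple X)
  end.

Lemma behead_cons_tuple T n (z : T) (X : n.-tuple T) : behead_tuple (cons_tuple z X) = X.
Proof. exact: val_inj. Qed.

Lemma contract_lieD n A W (f : multimap g n.+1) :
  contract W (lieD A f) = lieD A (contract W f) - contract_act A W f.
Proof. by apply/funext => X; rewrite /contract/= theadE behead_cons_tuple. Qed.

Lemma contract_cobd br n Z (f : multimap g n.+1) :
  contract Z (cobd br f) = lieD (br Z.1 Z.2) f - cobd br (contract Z f).
Proof. by apply/funext => X; rewrite /contract/= theadE behead_cons_tuple. Qed.

Lemma contract_is_linear n Z : linear (@contract n Z).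
Proof. by []. Qed.

HB.instance Definition _ n Z :=
  GRing.isLinear.Build K (multimap g n.+1) (multimap g n) _ (@contract n Z)
    (@contract_is_linear n Z).

Lemma contract_act_is_linear n A W : linear (@contract_act n A W).
Proof.
move=> a f h; rewrite /contract_act !linearP scalerDr; exact: addrACA.
Qed.

HB.instance Definition _ n A W :=
  GRing.isLinear.Build K (multimap g n.+1) (multimap g n) _ (@contract_act n A W)
    (@contract_act_is_linear n A W).

Lemma lieD_is_linear n (A : {linear g -> g}) : linear (@lieD n A).
Proof.
elim: n => [|n IHn] a f h.
  by apply/funext => X; apply/funext => x /=; rewrite !fctE linearP; vec_ring.
apply: multimap_eq => Z; rewrite linearP /= !contract_lieD !linearP /= IHn.
by rewrite addrACA -scalerDr.
Qed.

HB.instance Definition _ n (A : {linear g -> g}) :=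
  GRing.isLinear.Build K (multimap g n) (multimap g n) _ (@lieD n A)
    (@lieD_is_linear n A).

Lemma subst_at_cons0 n (Z W : g * g) (X : n.-tuple (g * g)) :
  subst_at (cons_tuple Z X) ord0 W = cons_tuple W X.
Proof.
apply: eq_from_tnth => i; rewrite tnth_mktuple.
by case: (unliftP ord0 i) => [j|] ->; rewrite ?eqxx ?tnth0 // !tnthS.
Qed.

Lemma subst_at_consS n (Z W : g * g) (X : n.-tuple (g * g)) (i : 'I_n) :
  subst_at (cons_tuple Z X) (lift ord0 i) W = cons_tuple Z (subst_at X i W).
Proof.
apply: eq_from_tnth => k; rewrite tnth_mktuple.
case: (unliftP ord0 k) => [j|] ->; last by rewrite !tnth0.
by rewrite !tnthS tnth_mktuple (inj_eq lift_inj).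
Qed.

Lemma is_cochain0 (f : multimap g 0) : is_cochain f <-> linear (f [tuple]).
Proof.
split=> [[linf _ _ _ _]|linf]; first exact: linf.
by split=> [X|_ []|_ []|_ []|_ []] //; rewrite (tuple0 X).
Qed.

(** The recursive description of cochains on which the inductions run.  The
    skew-symmetry in the last three vectors is inherited from the contractions,
    except in degree 1, where a contraction has a single argument left. *)
Lemma is_cochainS n (f : multimap g n.+1) :
  is_cochain f <->
  [/\ forall Z, is_cochain (contract Z f),
      forall y, linear (fun x => contract (x, y) f),
      forall x, linear (fun y => contract (x, y) f),
      forall x y, contract (y, x) f = - contract (x, y) f
    & n = 0%N -> forall X x y z,
        contract (x, z) f X y = - contract (x, y) f X z].
Proof.
split=> [[linf lin1 lin2 sk sk3]|[fC lin1 lin2 sk sk3]].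
  have c0 Z W X : contract W f X = f (subst_at (cons_tuple Z X) ord0 W).
    by rewrite subst_at_cons0.
  have cS Z W X i : contract Z f (subst_at X i W)
      = f (subst_at (cons_tuple Z X) (lift ord0 i) W).
    by rewrite subst_at_consS.
  split=> [Z|y a u v|x a u v|x y|n0 X x y z].
  - split=> [X|X i y z a u v|X i x z a u v|X i x y z|X i x y z ltin].
    + exact: linf.
    + by rewrite !cS lin1.
    + by rewrite !cS lin2.
    + by rewrite !cS sk.
    + by rewrite !cS sk3 // lift0 ltin.
  - apply/funext=> X; apply/funext=> z; rewrite !fctE.
    by rewrite !(c0 (0, 0)) lin1.
  - apply/funext=> X; apply/funext=> z; rewrite !fctE.
    by rewrite !(c0 (0, 0)) lin2.
  - apply/funext=> X; apply/funext=> z; rewrite !fctE.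
    by rewrite !(c0 (0, 0)) sk.
  - by rewrite !(c0 (0, 0)) sk3 // n0.
split=> [X|X i y z a u v|X i x z a u v|X i x y z|X i x y z].
- by case/tupleP: X => Z X; have [lin _ _ _ _] := fC Z; exact: (lin X).
- case/tupleP: X => Z X; case: (unliftP ord0 i) => [j|] ->.
    by rewrite !subst_at_consS; have [_ + _ _ _] := fC Z; exact.
  rewrite !subst_at_cons0.
  by have /(congr1 (fun h => h X z)) := lin1 y a u v; rewrite !fctE.
- case/tupleP: X => Z X; case: (unliftP ord0 i) => [j|] ->.
    by rewrite !subst_at_consS; have [_ _ + _ _] := fC Z; exact.
  rewrite !subst_at_cons0.
  by have /(congr1 (fun h => h X z)) := lin2 x a u v; rewrite !fctE.
- case/tupleP: X => Z X; case: (unliftP ord0 i) => [j|] ->.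
    by rewrite !subst_at_consS; have [_ _ _ + _] := fC Z; exact.
  rewrite !subst_at_cons0.
  by have /(congr1 (fun h => h X z)) := sk x y; rewrite !fctE.
- case/tupleP: X => Z X; case: (unliftP ord0 i) => [j|] -> => [|[n0]].
    by rewrite !subst_at_consS lift0 => -[jn]; have [_ _ _ _ +] := fC Z; exact.
  by rewrite !subst_at_cons0; exact: sk3.
Qed.

Lemma is_cochain_lincomb n a (f h : multimap g n) :
  is_cochain f -> is_cochain h -> is_cochain (a *: f + h).
Proof.
move=> [linf lf1 lf2 sf sf3] [linh lh1 lh2 sh sh3]; split.
- by move=> X b u v; rewrite !fctE linf linh; vec_ring.
- by move=> X i y z b u v; rewrite !fctE lf1 lh1; vec_ring.
- by move=> X i x z b u v; rewrite !fctE lf2 lh2; vec_ring.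
- by move=> X i x y z; rewrite !fctE sf sh; vec_ring.
- by move=> X i x y z ni; rewrite !fctE sf3 // sh3 //; vec_ring.
Qed.

Lemma is_cochainN n (f : multimap g n) : is_cochain f -> is_cochain (- f).
Proof.
move=> fC; have := is_cochain_lincomb (-1) fC (is_cochain_lincomb (-1) fC fC).
by rewrite !scaleN1r addNr addr0.
Qed.

Lemma is_cochainD n (f h : multimap g n) :
  is_cochain f -> is_cochain h -> is_cochain (f + h).
Proof. by move=> fC hC; rewrite -[f]scale1r; exact: is_cochain_lincomb. Qed.

Lemma is_cochainB n (f h : multimap g n) :
  is_cochain f -> is_cochain h -> is_cochain (f - h).
Proof. by move=> fC hC; apply: is_cochainD => //; apply: is_cochainN. Qed.

(** Linearity of the action in the endomorphism requires f to be multilinear,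
    since A is inserted in the arguments of f. *)
Lemma lieD_lincomb n a (A B : g -> g) (f : multimap g n) : is_cochain f ->
  lieD (fun x => a *: A x + B x) f = a *: lieD A f + lieD B f.
Proof.
elim: n f => [|n IHn] f fC.
  apply/funext => X; apply/funext => x /=; rewrite (tuple0 X) !fctE.
  by move/is_cochain0: fC => ->; vec_ring.
have /is_cochainS[fZ lf1 lf2 _ _] := fC.
apply: multimap_eq => Z.
rewrite contract_lieD (IHn _ (fZ Z)) contract_is_linear !contract_lieD.
by rewrite /contract_act lf1 lf2; mm_ring.
Qed.

Lemma lieD_cochain n (A : {linear g -> g}) (f : multimap g n) :
  is_cochain f -> is_cochain (lieD A f).
Proof.
elim: n f => [|n IHn] f fC.
  apply/is_cochain0 => a u v /=; move/is_cochain0: fC => linf.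
  by rewrite !(linearP, linf); vec_ring.
have /is_cochainS[fZ lf1 lf2 sf sf3] := fC.
apply/is_cochainS; split.
- by move=> Z; rewrite contract_lieD; apply: is_cochainB; auto; apply: is_cochainD.
- move=> y a u v; rewrite !contract_lieD /contract_act /= linearP !lf1 lieD_is_linear.
  by mm_ring.
- move=> x a u v; rewrite !contract_lieD /contract_act /= linearP !lf2 lieD_is_linear.
  by mm_ring.
- move=> x y; rewrite !contract_lieD /contract_act /=.
  by rewrite !(sf x) (sf (A x)) linearN; mm_ring.
- move=> n0; subst n => X x y z; rewrite !contract_lieD /contract_act /= !fctE /=.
  rewrite !(sf3 _ _ _ y z) // (sf3 _ _ _ (A y)) // (sf3 _ _ _ y (A z)) // linearN.
  by vec_ring.
Qed.

Lemma lieDB n (A : {linear g -> g}) (f h : multimap g n) :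
  lieD A (f - h) = lieD A f - lieD A h.
Proof. exact: linearB. Qed.

Lemma lieDN n (A : {linear g -> g}) (f : multimap g n) : lieD A (- f) = - lieD A f.
Proof. exact: linearN. Qed.

Lemma lieD0 n (A : {linear g -> g}) : lieD A (0 : multimap g n) = 0.
Proof. exact: linear0. Qed.

Lemma lieDD n (A : {linear g -> g}) (f h : multimap g n) :
  lieD A (f + h) = lieD A f + lieD A h.
Proof. exact: linearD. Qed.

(** In [A, B] acting on f, the terms where A and B hit different arguments
    cancel, and those where they hit the same argument form the commutator. *)
Lemma lieD_commutator n (A B : {linear g -> g}) (f : multimap g n) :
  is_cochain f ->
  lieD A (lieD B f) - lieD B (lieD A f) = lieD (fun x => A (B x) - B (A x)) f.
Proof.
elim: n f => [|n IHn] f fC.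
  apply/funext => X; apply/funext => x /=; rewrite (tuple0 X) !fctE /=.
  move/is_cochain0: fC => linf.
  by rewrite !linearB (zmod_morphism_linear linf) /=; vec_ring.
have /is_cochainS[fZ lf1 lf2 _ _] := fC.
apply: multimap_eq => Z; rewrite [RHS]contract_lieD -(IHn _ (fZ Z)).
rewrite [LHS]/(contract Z (lieD A (lieD B f)) - contract Z (lieD B (lieD A f))).
rewrite !contract_lieD /contract_act !contract_lieD /contract_act /=.
rewrite (zmod_morphism_linear (lf1 _)) (zmod_morphism_linear (lf2 _)).
by rewrite !lieDB !lieDD; mm_ring.
Qed.

End Cartan.

(** * The differential of a 3-Lie algebra *)

(** Used to give a bare function with a proof of linearity the canonical linear
    structure under which the lemmas on [lieD] are stated. *)
Lemma linear_as_map (K : fieldType) (U V : lmodType K) (f : U -> V) :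
  linear f -> exists F : {linear U -> V}, f = F.
Proof.
move=> linf.
by exists (HB.pack_for {linear U -> V} f (GRing.isLinear.Build K U V _ f linf)).
Qed.

Section ThreeLie.
Variables (K : fieldType) (g : vectType K) (br : g -> g -> g -> g).

Lemma contract_pi (Z : g * g) (X : 0.-tuple (g * g)) :
  contract Z (pi_cochain br) X = br Z.1 Z.2.
Proof. by []. Qed.

Lemma is_cochain_pi : trilinear br -> skew3 br -> is_cochain (pi_cochain br).
Proof.
move=> [lin1 lin2 lin3] [sk1 sk2]; apply/is_cochainS; split.
- by move=> Z; apply/is_cochain0; exact: lin3.
- move=> y a u v; apply/funext => X; apply/funext => z.
  by rewrite !fctE !contract_pi /= lin1.
- move=> x a u v; apply/funext => X; apply/funext => z.
  by rewrite !fctE !contract_pi /= lin2.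
- move=> x y; apply/funext => X; apply/funext => z.
  by rewrite !fctE !contract_pi /= sk1.
- by move=> _ X x y z; rewrite !contract_pi /= sk2.
Qed.

Hypotheses (tri : trilinear br) (skw : skew3 br).

Let piC := is_cochain_pi tri skw.

Lemma ad_is_linear_map x y : exists A : {linear g -> g}, br x y = A.
Proof. by apply: linear_as_map => a u v; have [_ _ ->] := tri. Qed.

Lemma cobd_is_linear n : linear (@cobd K g br n).
Proof.
elim: n => [|n IHn] a f h.
  rewrite -[LHS]/(- lieD (fun x => a *: f [tuple] x + h [tuple] x) (pi_cochain br)).
  by rewrite (lieD_lincomb a _ _ piC) opprD scalerN.
apply: multimap_eq => Z; rewrite contract_is_linear !contract_cobd.
have [A ->] := ad_is_linear_map Z.1 Z.2.
rewrite lieD_is_linear contract_is_linear IHn.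
by mm_ring.
Qed.

Lemma cobdD n (f h : multimap g n) : cobd br (f + h) = cobd br f + cobd br h.
Proof. by have := cobd_is_linear 1 f h; rewrite !scale1r. Qed.

Lemma cobdB n (f h : multimap g n) : cobd br (f - h) = cobd br f - cobd br h.
Proof. by rewrite (zmod_morphism_linear (@cobd_is_linear n)). Qed.

Lemma cobdN n (f : multimap g n) : cobd br (- f) = - cobd br f.
Proof. by rewrite -!scaleN1r (scalable_linear (@cobd_is_linear n)). Qed.

Lemma ad_lin1 y a u v : br (a *: u + v) y = (fun x => a *: br u y x + br v y x).
Proof. by apply/funext => x; have [-> _ _] := tri. Qed.

Lemma ad_lin2 x a u v : br x (a *: u + v) = (fun z => a *: br x u z + br x v z).
Proof. by apply/funext => z; have [_ -> _] := tri. Qed.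

(** The opposite is written as a linear combination so that [lieD_lincomb]
    applies to it. *)
Lemma ad_skew x y : br y x = (fun z => (-2%:R) *: br x y z + br x y z).
Proof. by apply/funext => z; have [-> _] := skw; vec_ring. Qed.

Lemma cobd_cochain n (f : multimap g n) : is_cochain f -> is_cochain (cobd br f).
Proof.
elim: n f => [|n IHn] f fC.
  apply: is_cochainN; have [F F_f] := linear_as_map ((is_cochain0 f).1 fC).
  by rewrite F_f; exact: lieD_cochain.
have /is_cochainS[fZ lf1 lf2 sf _] := fC.
apply/is_cochainS; split=> //.
- move=> Z; rewrite contract_cobd; apply: is_cochainB; last by apply: IHn.
  by have [A ->] := ad_is_linear_map Z.1 Z.2; exact: lieD_cochain.
- move=> y a u v; rewrite !contract_cobd ad_lin1 (lieD_lincomb a (br u y) (br v y) fC).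
  rewrite lf1 cobd_is_linear.
  by mm_ring.
- move=> x a u v; rewrite !contract_cobd ad_lin2 (lieD_lincomb a (br x u) (br x v) fC).
  rewrite lf2 cobd_is_linear.
  by mm_ring.
- move=> x y; rewrite !contract_cobd ad_skew (lieD_lincomb _ (br x y) (br x y) fC) (sf x).
  by rewrite cobdN; mm_ring.
Qed.

(** Contracted with a bivector, this is the Leibniz rule; see [derivation_ad]. *)
Definition derivation (A : g -> g) := lieD A (pi_cochain br) = 0.

(** The Leibniz rule in operator form: the commutator of a derivation A and of
    ad_Z is ad of the action of A on Z. *)
Lemma derivation_ad A Z : derivation A ->
  (fun x => A (br Z.1 Z.2 x) - br Z.1 Z.2 (A x)) =
  (fun x => 1 *: br (A Z.1) Z.2 x + br Z.1 (A Z.2) x).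
Proof.
move=> dA; apply/funext => x.
have := congr1 (fun f => f (cons_tuple Z [tuple]) x) dA.
rewrite -[LHS]/(contract Z (lieD A (pi_cochain br)) [tuple] x) contract_lieD.
rewrite /contract_act !fctE /= !contract_pi.
by move/eqP; rewrite subr_eq0 => /eqP ->; rewrite scale1r.
Qed.

(** In degree 0, A and f commute past each other on pi up to [A, f], and A kills
    pi.  In higher degree, Cartan's formula reduces the claim to the contraction of
    f, the remaining terms being the commutator of A and ad_Z. *)
Lemma lieD_cobd n (A : {linear g -> g}) (f : multimap g n) :
  derivation A -> is_cochain f -> lieD A (cobd br f) = cobd br (lieD A f).
Proof.
move=> dA; elim: n f => [|n IHn] f fC.
  have [F F_f] := linear_as_map ((is_cochain0 f).1 fC).
  have := lieD_commutator A F piC; rewrite dA lieD0 subr0 -F_f => E.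
  rewrite -[cobd br f]/(- lieD (f [tuple]) (pi_cochain br)) F_f lieDN -F_f E.
  by [].
have /is_cochainS[fZ lf1 lf2 sf _] := fC.
apply: multimap_eq => Z; rewrite contract_cobd !contract_lieD /contract_act.
rewrite !contract_cobd lieDB (IHn _ (fZ Z)) cobdB cobdD.
have [B adB] := ad_is_linear_map Z.1 Z.2.
have := lieD_commutator A B fC; rewrite -adB derivation_ad //.
rewrite (lieD_lincomb 1 (br (A Z.1) Z.2) (br Z.1 (A Z.2)) fC) scale1r.
rewrite adB => /eqP; rewrite subr_eq => /eqP ->.
by mm_ring.
Qed.

(** In degree 0, the contraction of the differential of an endomorphism f is
    lieD ad_Z f plus the operator ad of f acting on Z; the differential of any
    ad_W vanishes because ad_W is a derivation, so [lieD_cobd] concludes.  In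
    higher degree, apply Cartan's formula twice. *)
Lemma cobd_cobd n (f : multimap g n) :
  (forall Z, derivation (br Z.1 Z.2)) -> is_cochain f ->
  cobd br (cobd br f) = 0.
Proof.
move=> dad; elim: n f => [|n IHn] f fC; apply: multimap_eq => Z.
  rewrite contract_cobd; have [B adB] := ad_is_linear_map Z.1 Z.2.
  rewrite adB lieD_cobd //; last by rewrite -adB; exact: dad.
  (* contract W pi is the endomorphism ad_W, whose differential is - lieD ad_W pi. *)
  have cob0 W : cobd br (contract W (pi_cochain br)) = 0.
    by rewrite -[LHS]/(- lieD (br W.1 W.2) (pi_cochain br)) dad oppr0.
  have -> : contract Z (cobd br f)
     = lieD B f + contract_act (f [tuple]) Z (pi_cochain br).
    rewrite -[LHS]/(- contract Z (lieD (f [tuple]) (pi_cochain br))).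
    rewrite contract_lieD opprB addrC; congr (_ + _).
    apply/funext => X; apply/funext => x; rewrite fctE /= (tuple0 X) !contract_pi.
    by rewrite opprB -adB.
  by rewrite cobdD /contract_act cobdD !cob0 !addr0 subrr.
have /is_cochainS[fZ _ _ _ _] := fC.
rewrite contract_cobd contract_cobd cobdB (IHn _ (fZ Z)).
have [B adB] := ad_is_linear_map Z.1 Z.2.
by rewrite adB lieD_cobd // -?adB ?subr0 ?subrr.
Qed.

End ThreeLie.

(** * Polarisation *)

Section Polarisation.
Variables (K : fieldType) (g : vectType K).

Lemma trilinear_additive (br : g -> g -> g -> g) : trilinear br ->
  [/\ forall u v y z, br (u + v) y z = br u y z + br v y z,
      forall x u v z, br x (u + v) z = br x u z + br x v z
    & forall x y u v, br x y (u + v) = br x y u + br x y v].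
Proof.
move=> [lin1 lin2 lin3]; split=> *.
- by rewrite -[X in X + _]scale1r lin1 scale1r.
- by rewrite -[X in X + _]scale1r lin2 scale1r.
- by rewrite -[X in X + _]scale1r lin3 scale1r.
Qed.

(** This is the fundamental identity, read as a property of ad_Z. *)
Lemma three_Lie_derivation (br : g -> g -> g -> g) (Z : g * g) :
  three_Lie br -> derivation br (br Z.1 Z.2).
Proof.
move=> [_ _ fund]; apply: multimap_eq => W; rewrite contract_lieD /contract_act.
apply/funext => X; apply/funext => x; rewrite !fctE /= !contract_pi /= fund.
by vec_ring.
Qed.

Lemma three_Lie_cobd_cobd (br : g -> g -> g -> g) n (f : multimap g n) :
  three_Lie br -> is_cochain f -> cobd br (cobd br f) = 0.
Proof.
move=> brL fC; have [tri skw _] := brL.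
by apply: cobd_cobd => // Z; exact: three_Lie_derivation.
Qed.

Variables br1 br2 : g -> g -> g -> g.
Let br12 x y z := br1 x y z + br2 x y z.

(** The cross terms of the fundamental identity for the sum are exactly the
    compatibility condition. *)
Lemma three_Lie_add : compatible_three_Lie br1 br2 -> three_Lie br12.
Proof.
move=> [[[l11 l12 l13] [s11 s12] f1] [[l21 l22 l23] [s21 s22] f2] c]; split.
- split; move=> x y a u v; rewrite /br12.
  + by rewrite l11 l21; vec_ring.
  + by rewrite l12 l22; vec_ring.
  + by rewrite l13 l23; vec_ring.
- split=> x y z; rewrite /br12.
  + by rewrite s11 s21; vec_ring.
  + by rewrite s12 s22; vec_ring.
move=> x1 x2 x3 x4 x5; rewrite /br12.
have [a1 a2 a3] := trilinear_additive (And3 l11 l12 l13).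
have [b1 b2 b3] := trilinear_additive (And3 l21 l22 l23).
rewrite !(a1, a2, a3, b1, b2, b3) f1 f2.
rewrite (canRL (addKr _) (c x1 x2 x3 x4 x5)).
by vec_ring.
Qed.

Hypothesis compat : compatible_three_Lie br1 br2.

Lemma cobd_bracketD n (f : multimap g n) : is_cochain f ->
  cobd br12 f = cobd br1 f + cobd br2 f.
Proof.
elim: n f => [|n IHn] f fC.
  have [F F_f] := linear_as_map ((is_cochain0 f).1 fC).
  rewrite -[LHS]/(- lieD (f [tuple]) (pi_cochain br1 + pi_cochain br2)).
  by rewrite F_f lieDD -F_f opprD.
have /is_cochainS[fZ _ _ _ _] := fC.
apply: multimap_eq => Z.
rewrite -[contract Z (_ + _)]/(contract Z (cobd br1 f) + contract Z (cobd br2 f)).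
rewrite !contract_cobd (IHn _ (fZ Z)).
have -> : br12 Z.1 Z.2 = fun x => 1 *: br1 Z.1 Z.2 x + br2 Z.1 Z.2 x.
  by apply/funext => x; rewrite scale1r.
by rewrite (lieD_lincomb 1 (br1 Z.1 Z.2) (br2 Z.1 Z.2) fC) scale1r; mm_ring.
Qed.

(** The mixed terms in the square of the differential of br1 + br2, whose other
    terms vanish. *)
Lemma cobd_anticomm n (f : multimap g n) : is_cochain f ->
  cobd br1 (cobd br2 f) + cobd br2 (cobd br1 f) = 0.
Proof.
move=> fC; have [L1 L2 _] := compat; have L12 := three_Lie_add compat.
have [t1 k1 _] := L1; have [t2 k2 _] := L2; have [t12 k12 _] := L12.
have C1 := cobd_cochain t1 k1 fC; have C2 := cobd_cochain t2 k2 fC.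
have := three_Lie_cobd_cobd L12 fC.
rewrite (cobd_bracketD fC) cobdD // !cobd_bracketD // !three_Lie_cobd_cobd // add0r addr0.
by rewrite addrC.
Qed.

End Polarisation.

(** * Shuffles with a block of size one *)

(** An increasing map satisfies i <= v i; conjugating by the order reversal
    gives the opposite inequality. *)
Lemma increasing_ord_id n (u : 'I_n -> 'I_n) :
  {homo u : i j / (i < j)%N} -> u =1 id.
Proof.
have le_incr (v : 'I_n -> 'I_n) :
    {homo v : i j / (i < j)%N} -> forall i : 'I_n, (i <= v i)%N.
  move=> incr_v [i lt_in]; elim: i lt_in => // i IHi lt_in /=.
  have := IHi (ltnW lt_in); have := incr_v (Ordinal (ltnW lt_in)) (Ordinal lt_in).
  by move=> /(_ (ltnSn i)) /=; lia.
move=> incr_u i; apply: val_inj; apply/eqP; rewrite eqn_leq (le_incr u) // andbT.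
have /le_incr/(_ (rev_ord i)) :
    {homo @rev_ord n \o u \o @rev_ord n : a b / (a < b)%N}.
  move=> a b lt_ab /=; have lt_u : (u (rev_ord b) < u (rev_ord a))%N.
    by apply: incr_u => /=; have := ltn_ord b; lia.
  by have := ltn_ord (u (rev_ord a)); lia.
by rewrite /= rev_ordK; have := ltn_ord (u i); have := ltn_ord i; lia.
Qed.

(** Once the value at a is removed, the permutation restricts to an increasing
    self-map of 'I_n, which is the identity. *)
Lemma increasing_off_lift_perm n (a : 'I_n.+1) (s : 'S_n.+1) :
  (forall i j : 'I_n, (i < j)%N -> (s (lift a i) < s (lift a j))%N) ->
  s = lift_perm a (s a) 1.
Proof.
move=> incr_s.
have s_off i : s a != s (lift a i) by rewrite (inj_eq perm_inj) neq_lift.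
pose u i := odflt i (unlift (s a) (s (lift a i))).
have uE i : s (lift a i) = lift (s a) (u i).
  by rewrite /u; have [j -> ->] := unlift_some (s_off i).
have u_id : u =1 id.
  apply: increasing_ord_id => i j /incr_s; rewrite !uE /= /bump; lia.
apply/permP => i; case: (unliftP a i) => [j|] ->; last by rewrite lift_perm_id.
by rewrite lift_perm_lift perm1 uE u_id.
Qed.

Lemma sum_increasing_off (V : nmodType) n (a : 'I_n.+1) (F : 'S_n.+1 -> V) :
  \sum_(s : 'S_n.+1 | [forall i : 'I_n, forall j : 'I_n,
       (i < j)%N ==> (s (lift a i) < s (lift a j))%N]) F s =
  \sum_j F (lift_perm a j 1).
Proof.
rewrite (reindex_onto (fun j => lift_perm a j 1) (fun s : 'S__ => s a)) /=.
  apply: eq_bigl => j; rewrite lift_perm_id eqxx andbT.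
  apply/forallP => i; apply/forallP => i'; apply/implyP => lt_ii'.
  by rewrite !lift_perm_lift !perm1 /= /bump; lia.
move=> s /forallP incr_s; apply/esym/increasing_off_lift_perm => i j lt_ij.
by have /forallP/(_ j)/implyP := incr_s i; exact.
Qed.

Lemma sum_shuffles_0l (V : nmodType) q (F : 'S_q -> V) :
  \sum_(s in shuffles 0 q) F s = F 1%g.
Proof.
rewrite (big_pred1 (1%g : 'S_q)) // => s; rewrite inE /=; apply/idP/eqP => [incr_s | ->].
  apply/permP => i; rewrite perm1; apply: (increasing_ord_id (u := s)) => {}i j lt_ij.
  by have /forallP/(_ i)/forallP/(_ j)/implyP := incr_s; apply; rewrite lt_ij.
by apply/forallP => i; apply/forallP => j; apply/implyP; rewrite !perm1 andbT.
Qed.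

(** The summand is presented as a function G of the sign and of the two blocks
    of values, which is all that a summand of a composition depends on. *)
Lemma sum_shuffles_1l (V : nmodType) q
    (G : bool -> ('I_1 -> nat) -> ('I_q -> nat) -> V) :
  \sum_(s in shuffles 1 q)
     G s (fun i => s (lshift q i)) (fun i => s (rshift 1 i)) =
  \sum_(j < q.+1) G (odd j) (fun=> j) (fun i => bump j i).
Proof.
have rS (i : 'I_q) : rshift 1 i = lift ord0 i by exact: val_inj.
transitivity (\sum_(j < q.+1) let s := lift_perm ord0 j 1 : 'S_q.+1 in
    G s (fun i => s (lshift q i)) (fun i => s (rshift 1 i))); last first.
  apply: eq_bigr => j _ /=; congr G.
  - by rewrite odd_lift_perm odd_perm1 addbF.
  - apply/funext => i; rewrite (_ : lshift q i = ord0) ?lift_perm_id //.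
    by apply: val_inj; rewrite ord1.
  - by apply/funext => i; rewrite rS lift_perm_lift perm1.
rewrite -(sum_increasing_off ord0 (fun s : 'S_q.+1 =>
  G s (fun i => s (lshift q i)) (fun i => s (rshift 1 i)))).
apply: eq_bigl => s; rewrite inE; apply/idP/idP => /forallP incr_s.
  apply/forallP => i; apply/forallP => j.
  by have /forallP/(_ (lift ord0 j)) := incr_s (lift ord0 i); rewrite andbT.
apply/forallP => i; apply/forallP => j; apply/implyP => /andP[lt_ij].
case: (unliftP ord0 i) lt_ij => [i'|] -> //; case: (unliftP ord0 j) => [j'|] -> //.
by move=> lt_ij _; have /forallP/(_ j')/implyP := incr_s i'; apply.
Qed.

Lemma sum_shuffles_1r (V : nmodType) k
    (G : bool -> ('I_k -> nat) -> ('I_1 -> nat) -> V) :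
  \sum_(s in shuffles k 1)
     G s (fun i => s (lshift 1 i)) (fun i => s (rshift k i)) =
  \sum_(j < k.+1) G (odd (k + j)) (fun i => bump j i) (fun=> j).
Proof.
have lE (i : 'I_k) : val (lshift 1 i) = i by [].
have rE (i : 'I_1) : val (rshift k i) = k by rewrite ord1 /= addn0.
rewrite (eq_bigl (fun s : 'S_(k + 1) => [forall i : 'I_(k + 1), forall j : 'I_(k + 1),
      (i < j)%N && ((j < k) || (k <= i))%N ==> (s i < s j)%N])); last first.
  by move=> s; rewrite inE.
(* 'I_(k + 1) and 'I_k.+1 are not convertible: only the values of the two
   embeddings are kept, so that k + 1 can be rewritten everywhere. *)
move: (@lshift k 1) (@rshift k 1) lE rE; rewrite addn1 => l r lE rE.
have {}lE i : l i = lift ord_max i.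
  by apply: val_inj; rewrite lE /= /bump leqNgt ltn_ord.
have {}rE i : r i = ord_max by exact: val_inj.
transitivity (\sum_(j < k.+1) let s := lift_perm ord_max j 1 : 'S_k.+1 in
    G s (fun i => s (l i)) (fun i => s (r i))); last first.
  apply: eq_bigr => j _ /=; congr G.
  - by rewrite odd_lift_perm odd_perm1 addbF oddD.
  - by apply/funext => i; rewrite lE lift_perm_lift perm1.
  - by apply/funext => i; rewrite rE lift_perm_id.
rewrite -(sum_increasing_off ord_max (fun s : 'S_k.+1 =>
  G s (fun i => s (l i)) (fun i => s (r i)))).
apply: eq_bigl => s; apply/idP/idP => /forallP incr_s.
  apply/forallP => i; apply/forallP => j; apply/implyP => lt_ij.
  have /forallP/(_ (lift ord_max j))/implyP := incr_s (lift ord_max i); apply.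
  by rewrite !lift_max lt_ij ltn_ord.
apply/forallP => i; apply/forallP => j; apply/implyP => /andP[].
case: (unliftP ord_max i) => [i'|] ->; case: (unliftP ord_max j) => [j'|] ->;
  rewrite ?lift_max /= => lt_ij.
- by move=> _; have /forallP/(_ j')/implyP := incr_s i'; apply.
- by rewrite ltnn leqNgt ltn_ord.
- by move: lt_ij; rewrite ltnNge ltnW.
- by rewrite ltnn in lt_ij.
Qed.

(** * The bracket with pi in terms of the differential *)

Definition omit T n (j : 'I_n.+1) (X : n.+1.-tuple T) : n.-tuple T :=
  [tuple tnth X (lift j i) | i < n].

Lemma omit0_cons T n Z (X : n.-tuple T) : omit ord0 (cons_tuple Z X) = X.
Proof. by apply: eq_from_tnth => i; rewrite tnth_mktuple tnthS. Qed.

Lemma omitS_cons T n Z (X : n.+1.-tuple T) (j : 'I_n.+1) :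
  omit (lift ord0 j) (cons_tuple Z X) = cons_tuple Z (omit j X).
Proof.
apply: eq_from_tnth => i; rewrite tnth_mktuple.
case: (unliftP ord0 i) => [i'|] ->.
  rewrite tnthS tnth_mktuple.
  rewrite (_ : lift (lift ord0 j) _ = lift ord0 (lift j i')) ?tnthS //.
  by apply: val_inj => /=; rewrite bumpS.
by rewrite (_ : lift (lift ord0 j) _ = ord0) ?tnth0 //; exact: val_inj.
Qed.

Section Explicit.
Variables (K : fieldType) (g : vectType K).

(** The part of the action of A on f that concerns the k-th bivector. *)
Definition slot n (A : g -> g) (f : multimap g n) (X : n.-tuple (g * g)) (k : 'I_n) x :=
  f (subst_at X k (A (tnth X k).1, (tnth X k).2)) x +
  f (subst_at X k ((tnth X k).1, A (tnth X k).2)) x.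

Lemma slot0 n A (f : multimap g n.+1) Z X x :
  slot A f (cons_tuple Z X) ord0 x = contract_act A Z f X x.
Proof. by rewrite /slot tnth0 !subst_at_cons0. Qed.

Lemma slotS n A (f : multimap g n.+1) Z X (k : 'I_n) x :
  slot A f (cons_tuple Z X) (lift ord0 k) x = slot A (contract Z f) X k x.
Proof. by rewrite /slot tnthS !subst_at_consS. Qed.

Lemma lieDE n A (f : multimap g n) X x :
  lieD A f X x = A (f X x) - f X (A x) - \sum_(k < n) slot A f X k x.
Proof.
elim: n f X => [|n IHn] f X; first by rewrite big_ord0 subr0.
case/tupleP: X => Z X.
rewrite -[LHS]/(contract Z (lieD A f) X x) contract_lieD big_ord_recl slot0.
under eq_bigr do rewrite slotS.
by rewrite [LHS]/(_ - _) IHn; vec_ring.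
Qed.

Variable br : g -> g -> g -> g.

(** The differential with the recursion unrolled: the last entry acts through f
    (first term), and entry j acts on the value of f, on its vector and on the
    entries that come after it.  Only later entries occur because Cartan's formula
    removes the entries before j by contraction. *)
Lemma cobdE n (f : multimap g n) (X : n.+1.-tuple (g * g)) x :
  cobd br f X x =
  (-1) ^+ n *: contract_act (f (omit ord_max X)) (tnth X ord_max)
                 (pi_cochain br) [tuple] x +
  \sum_(j < n.+1) (-1) ^+ j *:
    (br (tnth X j).1 (tnth X j).2 (f (omit j X) x) -
     f (omit j X) (br (tnth X j).1 (tnth X j).2 x) -
     \sum_(k < n | (j <= k)%N)
        slot (br (tnth X j).1 (tnth X j).2) f (omit j X) k x).
Proof.
elim: n f X => [|n IHn] f X; case/tupleP: X => Z X; rewrite big_ord_recl.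
  rewrite !big_ord0 !expr0 !scale1r.
  rewrite -[LHS]/(- (contract Z (lieD (f [tuple]) (pi_cochain br)) X x)).
  rewrite contract_lieD (_ : ord_max = ord0); last exact: val_inj.
  rewrite !tnth0 omit0_cons (tuple0 X) /contract_act /= !fctE /= !contract_pi.
  by vec_ring.
rewrite -[LHS]/(contract Z (cobd br f) X x) contract_cobd omit0_cons tnth0.
rewrite [LHS]/(_ - _) lieDE IHn (_ : ord_max = lift ord0 ord_max); last exact: val_inj.
rewrite omitS_cons tnthS expr0 scale1r exprS mulN1r.
have slots A (j : 'I_n.+1) :
    \sum_(k < n.+1 | (lift ord0 j <= k)%N)
       slot A f (cons_tuple Z (omit j X)) k x =
    \sum_(k < n | (j <= k)%N) slot A (contract Z f) (omit j X) k x.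
  rewrite big_mkcond big_ord_recl /= add0r [RHS]big_mkcond.
  by apply: eq_bigr => k _; rewrite slotS.
under [X in _ = _ + (_ + X)]eq_bigr => j _.
  rewrite omitS_cons tnthS slots lift0 exprS mulN1r scaleNr; over.
rewrite sumrN; move: (\sum_(i < n.+1) _) => S; rewrite scaleNr.
rewrite -[LHS]/(_ - _ - _ - (_ + _)).
by vec_ring.
Qed.

Lemma omit_bump (T : nmodType) n (j : 'I_n.+1) (X : n.+1.-tuple T) :
  [tuple X`_(bump j i) | i < n] = omit j X.
Proof. by apply: eq_from_tnth => i; rewrite !tnth_mktuple (tnth_nth 0). Qed.

Lemma circ_piE n (f : multimap g n) (X : n.+1.-tuple (g * g)) x :
  circ (pi_cochain br) f X x =
  contract_act (f (omit ord_max X)) (tnth X ord_max) (pi_cochain br) [tuple] x +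
  \sum_(j < n.+1) (-1) ^+ n *: ((-1) ^+ j *:
     br (tnth X j).1 (tnth X j).2 (f (omit j X) x)).
Proof.
have pi1 (s : seq (g * g)) y :
    pi_cochain br (astuple 1 s) y = br (s`_0%N).1 (s`_0%N).2 y.
  by rewrite /pi_cochain /thead tnth_mktuple.
rewrite /circ !big_ord1 mul0n expr0 !scale1r !sum_shuffles_0l odd_perm1 expr0 !scale1r.
rewrite -scaler_sumr (sum_shuffles_1l (fun b l r => (-1) ^+ b *: pi_cochain br
  [tuple X`_(l i) | i < 1] (f [tuple X`_(r i) | i < n] x))).
congr (_ + _).
  rewrite !pi1 !nth_cat !size_tuple /=.
  rewrite (_ : [tuple _ | _ < n] = omit ord_max X); last first.
    rewrite -omit_bump; apply: eq_from_tnth => i; rewrite !tnth_mktuple perm1.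
    by rewrite /bump leqNgt ltn_ord.
  by rewrite (tnth_nth 0).
rewrite mul1n scaler_sumr; apply: eq_bigr => j _.
by rewrite signr_odd omit_bump /pi_cochain /thead tnth_mktuple -tnth_nth.
Qed.

(** For j <= k, position k of [omit j X] holds entry k.+1 of X: this is the
    entry that the composition replaces. *)
Lemma astuple_omit (T : nmodType) n (j : 'I_n.+1) (k : 'I_n) (X : n.+1.-tuple T) v :
  (j <= k)%N ->
  astuple n ([tuple X`_(bump j i) | i < k] ++ v :: drop (k + 1).+1 X) =
  subst_at (omit j X) k v.
Proof.
move=> le_jk; apply: eq_from_tnth => i; rewrite !tnth_mktuple nth_cat size_tuple.
case: ltngtP => [lt_ik|lt_ki|eq_ik].
- rewrite ifF; last by apply/eqP => i_k; rewrite i_k ltnn in lt_ik.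
  rewrite (tnth_nth 0) (nth_map (Ordinal lt_ik)) ?size_enum_ord //.
  by rewrite nth_enum_ord.
- rewrite ifF; last by apply/eqP => i_k; rewrite i_k ltnn in lt_ki.
  rewrite (tnth_nth 0) -[(i - k)%N]prednK ?subn_gt0 //= nth_drop.
  congr (_`_ _); rewrite /bump; lia.
- by rewrite (val_inj eq_ik) eqxx subnn.
Qed.

Lemma circE_pi n (f : multimap g n) (X : n.+1.-tuple (g * g))
    (X' : (n + 1).-tuple (g * g)) x : X' = X :> seq _ ->
  circ f (pi_cochain br) X' x =
  \sum_(j < n.+1) (-1) ^+ j *: (f (omit j X) (br (tnth X j).1 (tnth X j).2 x) +
     \sum_(k < n | (j <= k)%N)
        slot (br (tnth X j).1 (tnth X j).2) f (omit j X) k x).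
Proof.
move=> X'X; rewrite /circ X'X.
have pi1 (j : 'I_n.+1) y : pi_cochain br [tuple X`_j | _ < 1] y =
    br (tnth X j).1 (tnth X j).2 y.
  by rewrite /pi_cochain /thead tnth_mktuple -tnth_nth.
have sgn k j : (-1) ^+ (k * 1) * (-1) ^+ odd (k + j) = (-1) ^+ j :> K.
  by rewrite signr_odd muln1 exprD mulrA -expr2 sqrr_sign mul1r.
pose W1 (k : 'I_n) j := f (subst_at (omit j X) k
  (br (tnth X j).1 (tnth X j).2 (tnth (omit j X) k).1, (tnth (omit j X) k).2)) x.
pose W2 (k : 'I_n) j := f (subst_at (omit j X) k
  ((tnth (omit j X) k).1, br (tnth X j).1 (tnth X j).2 (tnth (omit j X) k).2)) x.
have Xk (k : 'I_n) (j : 'I_n.+1) : (j <= k)%N -> X`_(k + 1) = tnth (omit j X) k.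
  move=> le_jk; rewrite tnth_mktuple (tnth_nth 0) /= /bump le_jk; congr (_`_ _); lia.
have swap (W : 'I_n -> 'I_n.+1 -> g) :
    \sum_(k < n) \sum_(j < n.+1 | (j < k.+1)%N) (-1) ^+ j *: W k j =
    \sum_(j < n.+1) (-1) ^+ j *: \sum_(k < n | (j <= k)%N) W k j.
  rewrite (exchange_big_dep xpredT) //=; apply: eq_bigr => j _.
  by rewrite scaler_sumr.
have widen (k : 'I_n) (G : nat -> g) (W : 'I_n.+1 -> g) :
    (forall j : 'I_n.+1, (j <= k)%N -> G j = W j) ->
    (-1) ^+ (k * 1) *: (\sum_(j < k.+1) (-1) ^+ odd (k + j) *: G j) =
    \sum_(j < n.+1 | (j < k.+1)%N) (-1) ^+ j *: W j.
  move=> GW; rewrite scaler_sumr.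
  under eq_bigr => j _ do rewrite scalerA sgn.
  rewrite (big_ord_widen n.+1 (fun j => (-1) ^+ j *: G j)); last by rewrite ltnS ltnW.
  by apply: eq_bigr => j; rewrite ltnS => /GW ->.
(* W1 and W2 are the two halves of [slot]; the bound j < k.+1 on the position
   of the isolated entry is moved to a condition before the sums are swapped. *)
transitivity (
    \sum_(k < n) \sum_(j < n.+1 | (j < k.+1)%N) (-1) ^+ j *: W1 k j +
    \sum_(k < n) \sum_(j < n.+1 | (j < k.+1)%N) (-1) ^+ j *: W2 k j +
    \sum_(j < n.+1) (-1) ^+ j *: f (omit j X) (br (tnth X j).1 (tnth X j).2 x)).
  congr (_ + _ + _).
  - apply: eq_bigr => k _.
    rewrite (sum_shuffles_1r (fun b l r => (-1) ^+ b *: f (astuple n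
      ([tuple X`_(l i) | i < k] ++ (pi_cochain br [tuple X`_(r i) | i < 1]
         (X`_(k + 1)).1, (X`_(k + 1)).2) :: drop (k + 1).+1 X)) x)).
    rewrite (widen k (fun j => f (astuple n
      ([tuple X`_(bump j i) | i < k] ++ (pi_cochain br [tuple X`_j | _ < 1]
         (X`_(k + 1)).1, (X`_(k + 1)).2) :: drop (k + 1).+1 X)) x) (W1 k)) //.
    move=> j le_jk.
    by rewrite astuple_omit // pi1 (Xk _ _ le_jk).
  - apply: eq_bigr => k _.
    rewrite (sum_shuffles_1r (fun b l r => (-1) ^+ b *: f (astuple n
      ([tuple X`_(l i) | i < k] ++ ((X`_(k + 1)).1, pi_cochain br
         [tuple X`_(r i) | i < 1] (X`_(k + 1)).2) :: drop (k + 1).+1 X)) x)).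
    rewrite (widen k (fun j => f (astuple n
      ([tuple X`_(bump j i) | i < k] ++ ((X`_(k + 1)).1, pi_cochain br
         [tuple X`_j | _ < 1] (X`_(k + 1)).2) :: drop (k + 1).+1 X)) x) (W2 k)) //.
    move=> j le_jk.
    by rewrite astuple_omit // pi1 (Xk _ _ le_jk).
  - rewrite (sum_shuffles_1r (fun b l r => (-1) ^+ (n * 1) *: ((-1) ^+ b *:
      f [tuple X`_(l i) | i < n] (pi_cochain br [tuple X`_(r i) | i < 1] x)))).
    by apply: eq_bigr => j _; rewrite scalerA sgn omit_bump pi1.
rewrite !swap -!big_split; apply: eq_bigr => j _ /=.
by rewrite -!scalerDr -big_split addrC.
Qed.

Lemma bracket3Lie_pi n (f : multimap g n) :
  bracket3Lie (pi_cochain br) f = (-1) ^+ n *: cobd br f.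
Proof.
apply/funext => X; apply/funext => x.
rewrite /bracket3Lie circ_piE (circE_pi _ _ (val_tcast _ _)) mul1n.
rewrite [RHS]/(_ *: cobd br f X x) cobdE [RHS]scalerDr scalerA.
rewrite -expr2 sqrr_sign scale1r -addrA; congr (_ + _).
rewrite !scaler_sumr -sumrN -big_split; apply: eq_bigr => j _ /=.
by vec_ring.
Qed.

End Explicit.

(** * The complex of a compatible 3-Lie algebra *)

Section Complex.
Variables (K : fieldType) (g : vectType K) (br1 br2 : g -> g -> g -> g).

Lemma c3dE n (w : multimaps g n) i :
  c3d br1 br2 w i =
    (if unlift ord0 i is Some j then cobd br2 (w j) else 0) +
    (if unlift ord_max i is Some j then cobd br1 (w j) else 0).
Proof.
rewrite /c3d.
by case: (unlift ord0 i) => [j|]; case: (unlift ord_max i) => [j'|];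
  rewrite ?bracket3Lie_pi scalerDr ?scaler0 ?scalerA -?expr2 ?sqrr_sign ?scale1r.
Qed.

Lemma zero_is_cochain n : is_cochain (0 : multimap g n).
Proof.
have zeroE X x : (0 : multimap g n) X x = 0 by [].
by split=> [X a u v|X i y z a u v|X i x z a u v|X i x y z|X i x y z _];
  rewrite !zeroE ?scaler0 ?addr0 ?oppr0.
Qed.

Hypotheses (tri1 : trilinear br1) (skw1 : skew3 br1).
Hypotheses (tri2 : trilinear br2) (skw2 : skew3 br2).

Lemma c3d_linear n : linear (c3d br1 br2 (n := n)).
Proof.
move=> a u v; apply/funext => i.
rewrite c3dE [RHS]/(a *: c3d br1 br2 u i + c3d br1 br2 v i) !c3dE.
case: (unlift ord0 i) => [j|]; case: (unlift ord_max i) => [j'|];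
  rewrite ?(add0r, addr0, scaler0) //.
- by rewrite !cobd_is_linear // scalerDr addrACA.
- by rewrite cobd_is_linear.
- by rewrite cobd_is_linear.
- exact: esym (addr0 _).
Qed.

Lemma c3d_cochain n (w : multimaps g n) :
  is_c3cochain w -> is_c3cochain (c3d br1 br2 w).
Proof.
move=> wC i; rewrite c3dE; apply: is_cochainD.
- by case: unlift => [j|]; [exact: cobd_cochain | exact: zero_is_cochain].
- by case: unlift => [j|]; [exact: cobd_cochain | exact: zero_is_cochain].
Qed.

(** Extension by zero outside of the index range, so that the components of
    [c3d] follow one formula without boundary cases at the upper end. *)
Definition pad n (w : multimaps g n) (m : nat) : multimap g n :=
  oapp w 0 (insub m).

Lemma pad_ord n (w : multimaps g n) (i : 'I_n.+1) : pad w i = w i.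
Proof. by rewrite /pad valK. Qed.

Lemma pad_out n (w : multimaps g n) m : (n < m)%N -> pad w m = 0.
Proof. by move=> lt_nm; rewrite /pad insubN // -leqNgt. Qed.

Lemma pad_cochain n (w : multimaps g n) m : is_c3cochain w -> is_cochain (pad w m).
Proof.
by move=> wC; rewrite /pad; case: insub => [j|] /=;
  [exact: wC | exact: zero_is_cochain].
Qed.

Lemma cobd_zero br n : trilinear br -> skew3 br -> cobd br (0 : multimap g n) = 0.
Proof. by move=> tri skw; rewrite -(subrr 0) cobdB // subrr. Qed.

Lemma pad_c3d n (w : multimaps g n) m :
  pad (c3d br1 br2 w) m =
    (if m is m'.+1 then cobd br2 (pad w m') else 0) + cobd br1 (pad w m).
Proof.
have [lt_mn|le_nm] := ltnP m n.+2; last first.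
  by case: m le_nm => // m le_nm; rewrite !pad_out ?cobd_zero ?addr0 //; lia.
rewrite -[m]/(nat_of_ord (Ordinal lt_mn)); move: (Ordinal lt_mn) => i {m lt_mn}.
rewrite pad_ord c3dE; congr (_ + _).
  by case: unliftP => [j|] ->; rewrite ?lift0 /= ?pad_ord.
by case: unliftP => [j|] ->; [rewrite lift_max pad_ord | rewrite pad_out ?cobd_zero].
Qed.

End Complex.

Theorem theorem3p1 (K : closedFieldType) (char0 : [pchar K] =i pred0)
    (g : vectType K) (br1 br2 : g -> g -> g -> g)
    (compat : compatible_three_Lie br1 br2) (n : nat) :
  [/\ linear (c3d br1 br2 (n := n)),
      forall w : multimaps g n, is_c3cochain w -> is_c3cochain (c3d br1 br2 w)
    & forall w : multimaps g n, is_c3cochain w ->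
        c3d br1 br2 (c3d br1 br2 w) = 0].
Proof.
have [L1 L2 _] := compat; have [tri1 skw1 _] := L1; have [tri2 skw2 _] := L2.
split; first exact: c3d_linear.
  exact: c3d_cochain.
move=> w wC; apply/funext => i; rewrite -pad_ord.
have padC m := pad_cochain m wC.
case: (nat_of_ord i) => [|[|m]]; rewrite !pad_c3d // ?add0r.
- by rewrite three_Lie_cobd_cobd.
- by rewrite cobdD // three_Lie_cobd_cobd // addr0 addrC cobd_anticomm.
- rewrite !cobdD // !three_Lie_cobd_cobd // add0r addr0 addrC.
  by rewrite cobd_anticomm.
Qed.
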